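(* Let $S_n=(E_{n-m},K_m)$ be a word-representable split graph with $m\geq 4$, and let $d$ be an integer with $\frac{m+1}{2}< d\leq m-1$. Then $E_{n-m}$ contains at most $m-d+1$ vertices of degree $d$ having pairwise distinct neighbourhoods. Moreover, this bound is achievable: for every such $m$ and $d$ there is a word-representable split graph $(E_{n-m},K_m)$ whose independent set contains $m-d+1$ vertices of degree $d$ with pairwise distinct neighbourhoods.
   Context: A graph $G=(V,E)$ is word-representable if there exists a word $w$ over the alphabet $V$ such that for all distinct $x,y\in V$, the letters $x$ and $y$ alternate in $w$ if and only if $xy\in E$ (alternation meaning that deleting all letters other than $x$ and $y$ leaves $xyxy\cdots$ or $yxyx\cdots$). The notation $S_n=(E_{n-m},K_m)$ denotes a split graph on $n$ vertices whose vertex set is partitioned into a maximal clique $K_m$ on $m$ vertices and an independent set $E_{n-m}$ on $n-m$ vertices. *)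

(* Defs.v *)
From mathcomp Require Import all_boot.
Set Implicit Arguments. Unset Strict Implicit. Unset Printing Implicit Defensive.

Definition simple_graph (T : finType) (e : rel T) : Prop :=
  symmetric e /\ irreflexive e.

(* Letters x and y alternate in w: the restriction of w to {x, y} has no two
   consecutive equal letters, i.e. it is xyxy... or yxyx... *)
Definition alternate (T : eqType) (w : seq T) (x y : T) : bool :=
  let s := [seq z <- w | (z == x) || (z == y)] in
  path (fun a b => a != b) (head x s) (behead s).

Definition word_representable (T : finType) (e : rel T) : Prop :=
  exists w : seq T, (forall x : T, x \in w) /\
    (forall x y : T, x != y -> (alternate w x y <-> e x y)).

Definition nbhd (T : finType) (e : rel T) (x : T) : {set T} := [set y | e x y].
Definition deg (T : finType) (e : rel T) (x : T) : nat := #|nbhd e x|.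

Definition is_clique (T : finType) (e : rel T) (K : {set T}) : Prop :=
  forall x y, x \in K -> y \in K -> x != y -> e x y.

Definition is_independent (T : finType) (e : rel T) (I : {set T}) : Prop :=
  forall x y, x \in I -> y \in I -> ~~ e x y.

(* (E_{n-m}, K_m): vertex set partitioned into a maximal clique K (|K| = m)
   and an independent set E = complement of K. *)
Definition split_graph_with (T : finType) (e : rel T) (K : {set T}) (m : nat) : Prop :=
  [/\ simple_graph e, is_clique e K, #|K| = m,
      (forall v, v \notin K -> exists2 u, u \in K & ~~ e v u)
    & is_independent e (~: K)].

(* Main.v *)
Require Import Defs.
From mathcomp Require Import all_boot zify.
Set Implicit Arguments. Unset Strict Implicit. Unset Printing Implicit Defensive.

(** Write h_x(i) for the number of occurrences of x among the first i letters of
    w: then x and y alternate iff h_x - h_y stays in {0, 1} or in {-1, 0}. On a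
    clique K of size m, the word is periodic; with H the sum of the h_x, x in K,
    the height h_x is the integer part of (H + m - 1 - rank x) / m. For v outside
    K only the range [-lag, lead] of H - m h_v matters: it determines N(v), a
    cyclic interval of ranks starting at lead modulo m, and if |N(v)| = d < m then
    lead + lag = 2m - d. Two such vertices whose leads differ by an amount
    strictly between m - d and d alternate, so in an independent set leads
    differ by at most m - d or by at least d, and at most m - d + 1 leads are
    then distinct modulo m. *)

(** * Alternation in terms of prefix counts *)

Definition height (T : eqType) (w : seq T) (x : T) (i : nat) : nat :=
  count_mem x (take i w).

Definition dominates (T : eqType) (w : seq T) (x y : T) : Prop :=
  forall i, height w y i <= height w x i <= (height w y i).+1.

(** Starting the path at y forces the restricted word to begin with x. Once that x is read, the
    roles of x and y are swapped, hence the induction over both letters. *)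
Lemma path_neq_filterP (T : eqType) (w : seq T) (x y : T) : x != y ->
  path (fun a b => a != b) y [seq z <- w | (z == x) || (z == y)]
    <-> dominates w x y.
Proof.
elim: w x y => [|a w IHw] x y neq_xy; first by split=> // _ [].
have neq_yx : y != x by rewrite eq_sym.
rewrite /=; case: (eqVneq a x) => [->|neq_ax] /=.
  rewrite neq_yx /=.
  have -> : [seq z <- w | (z == x) || (z == y)]
          = [seq z <- w | (z == y) || (z == x)].
    by apply: eq_filter => z; rewrite orbC.
  rewrite IHw //; split=> dom.
    case=> [|i] //; move: (dom i).
    by rewrite /height /= eqxx (negPf neq_xy); lia.
  move=> i; move: (dom i.+1).
  by rewrite /height /= eqxx (negPf neq_xy); lia.
case: (eqVneq a y) => [->|neq_ay] /=.
  rewrite eqxx /=; split=> // /(_ 1).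
  by rewrite /height /= take0 /= eqxx (negPf neq_yx).
rewrite IHw //; split=> dom.
  case=> [|i] //; move: (dom i).
  by rewrite /height /= (negPf neq_ax) (negPf neq_ay); lia.
move=> i; move: (dom i.+1).
by rewrite /height /= (negPf neq_ax) (negPf neq_ay); lia.
Qed.

Lemma alternateP (T : eqType) (w : seq T) (x y : T) : x != y ->
  alternate w x y <-> dominates w x y \/ dominates w y x.
Proof.
move=> neq_xy; have neq_yx : y != x by rewrite eq_sym.
rewrite -(path_neq_filterP w neq_xy) -(path_neq_filterP w neq_yx).
have -> : [seq z <- w | (z == y) || (z == x)]
        = [seq z <- w | (z == x) || (z == y)].
  by apply: eq_filter => z; rewrite orbC.
rewrite /alternate.
have := filter_all (fun z => (z == x) || (z == y)) w.
case: [seq z <- w | _] => [|a s] /=; first by split=> // _; left.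
case/andP=> /orP[] /eqP-> _; rewrite eqxx.
  by rewrite neq_yx /=; split=> [|[]] //; left.
by rewrite neq_xy /=; split=> [|[]] //; right.
Qed.

Lemma alternate_sym (T : eqType) (w : seq T) (x y : T) :
  x != y -> alternate w x y <-> alternate w y x.
Proof.
move=> neq_xy; rewrite !alternateP // 1?eq_sym //.
by split=> -[]; [right|left|right|left].
Qed.

Lemma dominates_first (T : eqType) (w : seq T) (x y : T) :
  y \in w -> index y w < index x w -> ~ dominates w x y.
Proof.
move=> yw lt_yx /(_ (index y w).+1).
suff: height w x (index y w).+1 = 0 /\ 0 < height w y (index y w).+1.
  by case=> ->; lia.
rewrite /height; split.
  apply/count_memPn; apply/negP=> /index_ltn.
  by rewrite ltnS leqNgt lt_yx.
by rewrite -has_count has_pred1 in_take // ?index_size.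
Qed.

(** * Periodicity of the word on the clique *)

Definition rank (T : finType) (w : seq T) (K : {set T}) (x : T) : nat :=
  #|[set y in K | index y w < index x w]|.

Definition total_height (T : finType) (w : seq T) (K : {set T}) (i : nat) :=
  \sum_(y in K) height w y i.

Section Clique.

Variables (T : finType) (w : seq T) (K : {set T}).
Hypothesis w_full : forall x, x \in w.

Lemma rank_lt x : x \in K -> rank w K x < #|K|.
Proof.
move=> xK; apply: proper_card; rewrite properE; apply/andP; split.
  by apply/subsetP=> y; rewrite inE => /andP[].
by apply/subsetPn; exists x; rewrite // inE ltnn andbF.
Qed.

Lemma rank_inj : {in K &, injective (rank w K)}.
Proof.
have mono x y : x \in K -> index x w < index y w -> rank w K x < rank w K y.
  move=> xK lt_xy; apply: proper_card; rewrite properE; apply/andP; split.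
    apply/subsetP=> z; rewrite !inE => /andP[-> lt_zx] /=.
    exact: ltn_trans lt_xy.
  by apply/subsetPn; exists x; rewrite !inE ?xK ?lt_xy // ltnn andbF.
move=> x y xK yK eq_rank.
have [||] := ltngtP (index x w) (index y w).
- by move/(mono _ _ xK); rewrite eq_rank ltnn.
- by move/(mono _ _ yK); rewrite eq_rank ltnn.
by move/index_inj; apply.
Qed.

Hypothesis K_alt : forall x y, x \in K -> y \in K -> x != y -> alternate w x y.

Lemma dominates_rank x y : x \in K -> y \in K ->
  index y w < index x w -> dominates w y x.
Proof.
move=> xK yK lt_yx.
have neq_xy : x != y by apply: contraTneq lt_yx => ->; rewrite ltnn.
case: (iffLR (alternateP w neq_xy) (K_alt xK yK neq_xy)) => //.
by move/dominates_first => [].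
Qed.

(* Each of the [rank w K x] letters preceding x in its period is ahead of x by
   0 or 1, and each of the other letters of K is behind x by 0 or 1. *)
Lemma total_height_bounds x i : x \in K ->
  total_height w K i <= #|K| * height w x i + rank w K x
    < total_height w K i + #|K|.
Proof.
move=> xK; rewrite /total_height.
have -> : rank w K x = \sum_(y in K) (index y w < index x w).
  rewrite /rank -sum1_card big_mkcond [RHS]big_mkcond /=.
  by apply: eq_bigr => y _; rewrite inE; case: (y \in K).
have -> : #|K| * height w x i = \sum_(y in K) height w x i.
  by rewrite sum_nat_const.
have -> : #|K| = \sum_(y in K) 1 by rewrite sum1_card.
rewrite -!big_split /=.
have bd y : y \in K -> height w y i <= height w x i + (index y w < index x w)
    <= height w y i + (y != x).
  move=> yK; have [->|neq_yx] := eqVneq y x; first by rewrite ltnn addn0 leqnn.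
  have [lt_yx|lt_xy|/index_inj eq_yx] := ltngtP (index y w) (index x w).
  - by have := dominates_rank xK yK lt_yx i; lia.
  - by have := dominates_rank yK xK lt_xy i; lia.
  by rewrite eq_yx ?eqxx // in neq_yx.
apply/andP; split; first by apply: leq_sum => y /bd/andP[].
rewrite (bigD1 x) //= [ltnRHS](bigD1 x) //= ltnn addn0 -addSn addn1.
apply: leq_add => //; apply: leq_sum => y /andP[yK _].
by have := bd y yK; case: eqVneq => /=; lia.
Qed.

End Clique.

(** * Extreme deviations of a vertex from the clique *)

Definition lead (T : finType) (w : seq T) (K : {set T}) (v : T) : nat :=
  \max_(i < (size w).+1) (total_height w K i - #|K| * height w v i).

Definition lag (T : finType) (w : seq T) (K : {set T}) (v : T) : nat :=
  \max_(i < (size w).+1) (#|K| * height w v i - total_height w K i).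

Lemma height_minn (T : eqType) (w : seq T) (x : T) (i : nat) :
  height w x (minn i (size w)) = height w x i.
Proof.
rewrite /height; case: (leqP i (size w)) => // lt_wi.
by rewrite take_size take_oversize // ltnW.
Qed.

Lemma total_height_minn (T : finType) (w : seq T) (K : {set T}) (i : nat) :
  total_height w K (minn i (size w)) = total_height w K i.
Proof. by apply: eq_bigr => y _; rewrite height_minn. Qed.

(** Heights do not change past the end of [w], so the finite maximum controls every i. As H - m h_v
    is 0 at i = 0, truncated subtraction keeps its true maximum. *)
Lemma lead_leP (T : finType) (w : seq T) (K : {set T}) (v : T) (c : nat) :
  lead w K v <= c
    <-> forall i, total_height w K i <= #|K| * height w v i + c.
Proof.
split=> [/bigmax_leqP le_c i|le_c].
  have lt_i : minn i (size w) < (size w).+1 by rewrite ltnS geq_minr.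
  have /= := le_c (Ordinal lt_i) isT.
  by rewrite height_minn total_height_minn; lia.
by apply/bigmax_leqP => i _; have := le_c i; lia.
Qed.

Lemma lag_leP (T : finType) (w : seq T) (K : {set T}) (v : T) (c : nat) :
  lag w K v <= c
    <-> forall i, #|K| * height w v i <= total_height w K i + c.
Proof.
split=> [/bigmax_leqP le_c i|le_c].
  have lt_i : minn i (size w) < (size w).+1 by rewrite ltnS geq_minr.
  have /= := le_c (Ordinal lt_i) isT.
  by rewrite height_minn total_height_minn; lia.
by apply/bigmax_leqP => i _; have := le_c i; lia.
Qed.

(* For a vertex v of degree d, with [hi = lead w K v] and [nl = lag w K v], this
   is the cyclic interval hi, ..., hi + d - 1 of ranks modulo m. *)
Definition arc (m hi nl r : nat) : bool :=
  ((nl + r < m) && (hi <= m + r)) || ((hi <= r) && (nl + r < 2 * m)).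

Lemma count_iota_interval (a b n : nat) :
  count (fun i => a <= i < b) (iota 0 n) = minn b n - a.
Proof.
by elim: n => [|n IHn]; rewrite ?minn0 // -addn1 iotaD count_cat IHn /=; lia.
Qed.

Lemma card_ord_count (n : nat) (P : pred nat) :
  #|[set i : 'I_n | P i]| = count P (iota 0 n).
Proof.
rewrite cardsE -sum1_card -sum1_count -(big_mkord P (fun=> 1)).
by rewrite /index_iota subn0.
Qed.

(** If [hi] or [nl] exceeds m, the arc is an interval, nonempty as 0 < d; otherwise it is the
    complement of an interval, nonempty as d < m. So no difference is truncated. *)
Lemma count_arc (m hi nl d : nat) : 0 < d < m ->
  count (arc m hi nl) (iota 0 m) = d -> hi + nl + d = 2 * m.
Proof.
move=> /andP[d0 dm].
have [lt_mhi|le_him] := ltnP m hi.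
  rewrite (@eq_in_count _ _ (fun i => hi - m <= i < m - nl)); last first.
    by move=> r; rewrite mem_iota /arc; lia.
  by rewrite count_iota_interval; lia.
have [lt_mnl|le_nlm] := ltnP m nl.
  rewrite (@eq_in_count _ _ (fun i => hi <= i < 2 * m - nl)); last first.
    by move=> r; rewrite mem_iota /arc; lia.
  by rewrite count_iota_interval; lia.
rewrite (@eq_in_count _ _ (predC (fun i => m - nl <= i < hi))); last first.
  by move=> r; rewrite mem_iota /arc /=; lia.
have := count_predC (fun i => m - nl <= i < hi) (iota 0 m).
by rewrite count_iota_interval size_iota => E Ed; move: E; rewrite Ed; lia.
Qed.

(** * Neighbourhoods as cyclic intervals of ranks *)

Section Neighbourhoods.

Variables (T : finType) (w : seq T) (K : {set T}).
Hypothesis w_full : forall x, x \in w.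
Hypothesis K_alt : forall x y, x \in K -> y \in K -> x != y -> alternate w x y.

Let m := #|K|.

(** The first disjunct of [arc] encodes that x dominates v, the second that v dominates x. The
    bounds on m h_x become bounds on m h_v; the converse holds because heights are integers. *)
Lemma alternate_arc (x v : T) : x \in K -> v \notin K ->
  alternate w v x <-> arc m (lead w K v) (lag w K v) (rank w K x).
Proof.
move=> xK vK; have neq_vx : v != x by apply: contraNneq vK => ->.
have rk_lt := rank_lt w xK.
have bd i := total_height_bounds w_full K_alt i xK.
have m0 : 0 < m by rewrite /m; lia.
rewrite alternateP // /arc; split.
- case=> dom; apply/orP; [right|left]; apply/andP; split.
  + by apply/lead_leP => i; have := dom i; have := bd i; nia.
  + suff: lag w K v <= 2 * m - rank w K x - 1 by lia.
    by apply/lag_leP => i; have := dom i; have := bd i; rewrite -/m; nia.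
  + suff: lag w K v <= m - rank w K x - 1 by lia.
    by apply/lag_leP => i; have := dom i; have := bd i; rewrite -/m; nia.
  by apply/lead_leP => i; have := dom i; have := bd i; rewrite -/m; nia.
have lead_bd i := iffLR (lead_leP w K v _) (leqnn _) i.
have lag_bd i := iffLR (lag_leP w K v _) (leqnn _) i.
case/orP=> /andP[]; move=> h1 h2; [right|left]; move=> i;
  have := bd i; have := lead_bd i; have := lag_bd i; rewrite -/m; nia.
Qed.

(** The ranks of K are m distinct numbers below m, hence all of them. *)
Lemma card_rank (P : pred nat) :
  #|[set x in K | P (rank w K x)]| = count P (iota 0 m).
Proof.
have uniq_rk : uniq [seq rank w K x | x <- enum K].
  rewrite map_inj_in_uniq ?enum_uniq // => x y.
  by rewrite !mem_enum; apply: rank_inj.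
have sub_rk : {subset [seq rank w K x | x <- enum K] <= iota 0 m}.
  move=> r /mapP[x]; rewrite mem_enum => xK ->.
  by rewrite mem_iota rank_lt.
have [|_ eq_rk] := uniq_min_size uniq_rk sub_rk.
  by rewrite size_iota size_map -cardE.
have /permP <- := uniq_perm uniq_rk (iota_uniq 0 m) eq_rk.
rewrite count_map -size_filter cardE; apply: perm_size.
apply: uniq_perm => [||x]; [exact: enum_uniq| |].
  by apply: filter_uniq; apply: enum_uniq.
by rewrite mem_enum inE mem_filter mem_enum /= andbC.
Qed.

Lemma lead_lag_deg (v : T) (d : nat) : v \notin K -> 0 < d < m ->
  #|[set x in K | alternate w v x]| = d ->
  lead w K v + lag w K v + d = 2 * m.
Proof.
move=> vK d_bd card_d; apply: count_arc => //.
rewrite -card_rank -{}card_d; apply: eq_card => x; rewrite !inE.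
by case: (boolP (x \in K)) => //= xK; apply/idP/idP; apply alternate_arc.
Qed.

(** The number m (h_u - h_v) lies between -(lag v + lead u) and lead v + lag u. The gap between the
    leads makes these bounds greater than -m and less than 2m, so h_u - h_v is 0 or 1. *)
Lemma alternate_leads (u v : T) (d : nat) : d <= m ->
  lead w K u + lag w K u + d = 2 * m -> lead w K v + lag w K v + d = 2 * m ->
  m - d < lead w K v - lead w K u < d -> u != v -> alternate w u v.
Proof.
move=> le_dm Eu Ev bd neq_uv; apply/alternateP => //; left=> i.
have := iffLR (lead_leP w K u _) (leqnn _) i.
have := iffLR (lag_leP w K u _) (leqnn _) i.
have := iffLR (lead_leP w K v _) (leqnn _) i.
have := iffLR (lag_leP w K v _) (leqnn _) i.
rewrite -/m; nia.
Qed.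

End Neighbourhoods.

(** * Counting separated leads *)

Lemma card_le_interval (T : finType) (S : {set T}) (f : T -> nat) (a L : nat) :
  {in S &, injective f} -> (forall v, v \in S -> a <= f v < a + L) ->
  #|S| <= L.
Proof.
move=> f_inj f_bd; rewrite cardE -(size_map f) -(size_iota a L).
apply: uniq_leq_size => [|r /mapP[v]].
  rewrite map_inj_in_uniq ?enum_uniq // => x y.
  by rewrite !mem_enum; apply: f_inj.
by rewrite mem_enum mem_iota => /f_bd ? ->.
Qed.

(* A value in [L, m) is a wrapping arc, and the other arcs are intervals, with
   starting point [a v] < L. In each case the members of S are mapped
   injectively into an interval of length L: a wrapping arc at h excludes the intervals
   starting at a with h - d < a <= h - L, so h may be sent to h - L if all
   wrapping h are < 2L, and to h + L - m if all are >= m - L. Otherwise the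
   extreme wrapping arcs confine all a to a window of length L containing all
   h - L. *)
Lemma card_separated (T : finType) (S : {set T}) (h : T -> nat) (m d L : nat) :
  m + 1 = d + L -> 0 < L < d ->
  (forall v, v \in S -> h v < m + L) ->
  (forall u v, u \in S -> v \in S -> u != v ->
     [&& h u != h v, h u != h v + m & ~~ (h v + L <= h u < h v + d)]) ->
  #|S| <= L.
Proof.
move=> mE L_ltd h_bd h_sep.
pose P v := L <= h v < m.
pose a v := if h v < L then h v else h v - m.
have cls v : v \in S -> (P v = true /\ L <= h v < m) \/
    (P v = false /\ (h v < L /\ a v = h v) \/
     P v = false /\ (m <= h v < m + L /\ a v + m = h v)).
  move/h_bd; rewrite /P /a => hv.
  case: (ltnP (h v) L) => hL; first by right; left; lia.
  by case: (ltnP (h v) m) => hm; [left|right; right]; lia.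
have inj_of f : (forall u v, u \in S -> v \in S ->
      [&& h u != h v, h u != h v + m & ~~ (h v + L <= h u < h v + d)] ->
      [&& h v != h u, h v != h u + m & ~~ (h u + L <= h v < h u + d)] ->
      f u != f v :> nat) ->
    {in S &, injective f}.
  move=> f_neq u v uS vS; apply: contra_eq => neq_uv.
  by apply: f_neq; rewrite // h_sep // eq_sym.
case: (pickP [pred v | [&& v \in S, P v & 2 * L <= h v]])
    => [v1|small]; last first.
  have {}small v : v \in S -> P v -> h v < 2 * L.
    by move=> vS vP; have := small v; rewrite /= vS vP ltnNge /= => ->.
  apply: (@card_le_interval _ _ (fun v => if P v then h v - L else a v) 0).
    apply: inj_of => u v uS vS; move: (small u uS) (small v vS).
    by case: (cls u uS) => [[-> Hu]|[[-> [Hu ->]]|[-> [Hu Eu]]]];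
       case: (cls v vS) => [[-> Hv]|[[-> [Hv ->]]|[-> [Hv Ev]]]]; lia.
  move=> v vS; move: (small v vS).
  by case: (cls v vS) => [[-> Hv]|[[-> [Hv ->]]|[-> [Hv Ev]]]]; lia.
move=> /= /and3P[v1S v1P v1_bd].
case: (pickP [pred v | [&& v \in S, P v & h v < m - L]])
    => [v2|large]; last first.
  have {}large v : v \in S -> P v -> m <= h v + L.
    by move=> vS vP; have := large v; rewrite /= vS vP; lia.
  apply: (@card_le_interval _ _ (fun v => if P v then h v + L - m else a v) 0).
    apply: inj_of => u v uS vS; move: (large u uS) (large v vS).
    by case: (cls u uS) => [[-> Hu]|[[-> [Hu ->]]|[-> [Hu Eu]]]];
       case: (cls v vS) => [[-> Hv]|[[-> [Hv ->]]|[-> [Hv Ev]]]]; lia.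
  move=> v vS; move: (large v vS).
  by case: (cls v vS) => [[-> Hv]|[[-> [Hv ->]]|[-> [Hv Ev]]]]; lia.
move=> /= /and3P[v2S v2P v2_bd].
pose Q v := (v \in S) && P v.
have Qv2 : Q v2 by rewrite /Q v2S.
case: (arg_minnP h Qv2) => v0 /andP[v0S v0P] v0_min.
have le_v02 := v0_min v2 Qv2.
(* Wrapping leads lie in [L, m), so they differ by less than m - L = d - 1; separation then leaves
   only differences below L. *)
have Pwin v : v \in S -> P v -> h v0 <= h v < h v0 + L.
  move=> vS vP; rewrite v0_min /Q ?vS //=.
  have [->|neq_v] := eqVneq v v0; first by lia.
  by have := h_sep v v0 vS v0S neq_v; move: vP v0P; rewrite /P; lia.
have v1_win := Pwin v1 v1S v1P.
(* As h v0 < m - L, separation from [v0] forces a v > h v0 - L for every other arc, while a v < L <=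
   h v0. *)
apply: (@card_le_interval _ _ (fun v => if P v then h v - L else a v) (h v0 - L)).
  apply: inj_of => u v uS vS.
  by case: (cls u uS) => [[-> Hu]|[[-> [Hu ->]]|[-> [Hu Eu]]]];
     case: (cls v vS) => [[-> Hv]|[[-> [Hv ->]]|[-> [Hv Ev]]]]; lia.
move=> v vS; have vwin := Pwin v vS.
have neq v' : P v' -> P v = false -> v != v'.
  by move=> v'P vNP; apply: contraFneq vNP => ->.
have vsep v' : v' \in S -> P v' -> P v = false ->
    ~~ (h v' + L <= h v < h v' + d) && ~~ (h v + L <= h v' < h v + d).
  move=> v'S v'P /(neq _ v'P) neq_v.
  have /and3P[_ _ ->] := h_sep v v' vS v'S neq_v.
  by rewrite eq_sym in neq_v; have /and3P[] := h_sep v' v v'S vS neq_v.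
have sep0 := vsep v0 v0S v0P; have sep1 := vsep v1 v1S v1P.
move: v0P v1P v2P sep0 sep1 vwin; rewrite /(P v0) /(P v1) /(P v2).
by case: (cls v vS) => [[-> Hv]|[[-> [Hv ->]]|[-> [Hv Ev]]]] => v0P v1P v2P
  => [_ _ /(_ isT)|/(_ erefl) s0 /(_ erefl) s1 _
     |/(_ erefl) s0 /(_ erefl) s1 _]; lia.
Qed.

(** * The upper bound *)

Lemma word_representable_split_bound (T : finType) (e : rel T) (K : {set T})
    (m d : nat) :
  split_graph_with e K m -> word_representable e ->
  m + 1 < 2 * d -> d < m ->
  forall S : {set T}, S \subset ~: K ->
    (forall v, v \in S -> deg e v = d) ->
    {in S &, injective (nbhd e)} ->
    #|S| <= m - d + 1.
Proof.
move=> [[_ _] K_cl <- _ K_ind] [w [w_full w_alt]] md dm S S_sub S_deg S_inj.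
have K_alt x y : x \in K -> y \in K -> x != y -> alternate w x y.
  by move=> xK yK neq_xy; apply/w_alt/K_cl.
have SK v : v \in S -> v \notin K by move/(subsetP S_sub); rewrite inE.
have nbhdE v : v \in S -> nbhd e v = [set x in K | alternate w v x].
  move=> vS; apply/setP=> x; rewrite !inE; have [xK|xK] := boolP (x \in K).
    have neq_vx : v != x by apply: contraNneq (SK v vS) => ->.
    by apply/idP/idP; apply w_alt.
  by apply/negbTE/K_ind; rewrite inE // SK.
have lead_lag v : v \in S -> lead w K v + lag w K v + d = 2 * #|K|.
  move=> vS; apply: lead_lag_deg; rewrite ?SK //; first by lia.
  by rewrite -nbhdE // -[LHS]/(deg e v) S_deg.
apply: (card_separated (h := lead w K) (m := #|K|) (d := d)); try lia.
  by move=> v /lead_lag; lia.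
move=> u v uS vS neq_uv.
have Eu := lead_lag u uS; have Ev := lead_lag v vS.
(* Leads that are equal or differ by m define the same arc, which distinct neighbourhoods forbid. *)
have arcs_neq : ~ {in iota 0 #|K|, arc #|K| (lead w K u) (lag w K u)
                      =1 arc #|K| (lead w K v) (lag w K v)}.
  move=> eq_arc; case/eqP: neq_uv; apply: S_inj => //; rewrite !nbhdE //.
  apply/setP=> x; rewrite !inE; case: (boolP (x \in K)) => //= xK.
  have := alternate_arc w_full K_alt xK (SK u uS).
  have := alternate_arc w_full K_alt xK (SK v vS).
  rewrite eq_arc ?mem_iota ?rank_lt // => iff_v iff_u.
  by apply/idP/idP => [/iff_u/iff_v|/iff_v/iff_u].
apply/and3P; split.
- apply/eqP=> eq_uv; apply: arcs_neq => r.
  by rewrite mem_iota /arc; lia.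
- apply/eqP=> eq_uv; apply: arcs_neq => r.
  by rewrite mem_iota /arc; lia.
apply/negP=> bd; have neq_vu : v != u by rewrite eq_sym.
have {}bd : #|K| - d < lead w K u - lead w K v < d by lia.
have := alternate_leads (ltnW dm) Ev Eu bd neq_vu.
by move/w_alt => /(_ neq_vu); apply/negP/K_ind; rewrite inE SK.
Qed.

(** * A graph attaining the bound *)

Section Extremal.

Variables (m d L : nat).
Hypotheses (mE : m + 1 = d + L) (L_gt1 : 1 < L) (L_ltd : L < d).

(* The word A_{L-1} ... A_0 0 1 ... (m-1) followed by 0 1 ... (m-1) in which
   A_a is inserted just before the letter a and just after the letter a+d-1, so
   that A_a and a letter of its neighbourhood a, ..., a+d-1 alternate, while
   two letters A_a, A_b with a < b read b a a b a b. The letter A_a has code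
   m + a, and [extremal_code t] is the letter at position t. *)
Definition extremal_code (t : nat) : nat :=
  if t < L then m + (L - t.+1) else if t < L + m then t - L else
  let s := t - (L + m) in
  if s < 2 * L then (if odd s then s./2 else m + s./2) else
  if s < L + d then s - L else
  let u := s - (L + d) in if odd u then d + u./2 else m + u./2.

(* The position of the second occurrence of the letter j < m. *)
Definition clique_time (j : nat) : nat :=
  L + m + (if j < L then 2 * j + 1 else if j < d then L + j
           else L + 2 * j + 1 - d).

Definition extremal_height (x i : nat) : nat :=
  if x < m then (L + x < i) + (clique_time x < i)
  else let a := x - m in
       (L - a.+1 < i) + (L + m + 2 * a < i) + (2 * L + m + d + 2 * a < i).

Lemma extremal_code_lt t : t < 2 * m + 3 * L -> extremal_code t < m + L.
Proof. by rewrite /extremal_code; do ?case: ifP; lia. Qed.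

Lemma count_extremal_code x i : x < m + L -> i <= 2 * m + 3 * L ->
  count (fun t => extremal_code t == x) (iota 0 i) = extremal_height x i.
Proof.
move=> x_lt; elim: i => [|i IHi] i_le.
  by rewrite /= /extremal_height; case: ifP; lia.
rewrite -[in iota _ _]addn1 iotaD count_cat IHi ?(ltnW i_le) //= add0n addn0.
rewrite /extremal_height /clique_time /extremal_code.
do ?case: ifP; lia.
Qed.

Lemma extremal_order_gt0 : 0 < m + L.
Proof. lia. Qed.

(** The default of [insubd] is never taken: [extremal_code_lt] covers all positions used. *)
Definition extremal_word : seq 'I_(m + L) :=
  [seq insubd (Ordinal extremal_order_gt0) (extremal_code t)
  | t <- iota 0 (2 * m + 3 * L)].

Lemma height_extremal_word (x : 'I_(m + L)) i : i <= 2 * m + 3 * L ->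
  height extremal_word x i = extremal_height x i.
Proof.
move=> i_le; rewrite -count_extremal_code // /height /extremal_word -map_take.
rewrite take_iota (minn_idPl i_le) count_map; apply: eq_in_count => t.
rewrite mem_iota /= -val_eqE val_insubd => t_lt.
by rewrite extremal_code_lt //; lia.
Qed.

Lemma size_extremal_word : size extremal_word = 2 * m + 3 * L.
Proof. by rewrite size_map size_iota. Qed.

Lemma dominates_extremal (x y : 'I_(m + L)) :
  dominates extremal_word x y <->
  forall i, i <= 2 * m + 3 * L ->
    extremal_height y i <= extremal_height x i <= (extremal_height y i).+1.
Proof.
split=> dom i => [i_le|].
  by rewrite -!height_extremal_word.
rewrite -(height_minn _ x) -(height_minn _ y) size_extremal_word.
by rewrite !height_extremal_word ?geq_minr //; apply/dom/geq_minr.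
Qed.

Definition extremal_adj (x y : 'I_(m + L)) : bool :=
  if x < m then (if y < m then x != y else y - m <= x < y - m + d)
  else (y < m) && (x - m <= y < x - m + d).

Lemma extremal_adj_sym : symmetric extremal_adj.
Proof.
by move=> x y; rewrite /extremal_adj eq_sym; case: (x < m); case: (y < m).
Qed.

Lemma alternate_extremal (x y : 'I_(m + L)) : x < y ->
  alternate extremal_word x y <-> extremal_adj x y.
Proof.
move=> lt_xy; have neq_xy : x != y by rewrite -val_eqE /=; lia.
have x_lt := ltn_ord x; have y_lt := ltn_ord y.
rewrite alternateP // !dominates_extremal /extremal_adj neq_xy.
case: (ltnP y m) => y_m.
  have x_m : x < m by lia.
  rewrite x_m; split=> // _; left=> i i_le.
  by rewrite /extremal_height x_m y_m /clique_time; do ?case: ifP; lia.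
have hy i : extremal_height y i = (L - (y - m).+1 < i)
    + (L + m + 2 * (y - m) < i) + (2 * L + m + d + 2 * (y - m) < i).
  by rewrite /extremal_height ltnNge y_m.
case: (ltnP x m) => x_m /=; last first.
  have hx i : extremal_height x i = (L - (x - m).+1 < i)
      + (L + m + 2 * (x - m) < i) + (2 * L + m + d + 2 * (x - m) < i).
    by rewrite /extremal_height ltnNge x_m.
  (* The restriction begins y x x: the first y refutes that x dominates, the second x that y
     does. *)
  split=> // -[] dom.
    by have := dom (L - (y - m)) ltac:(lia); rewrite hx hy; lia.
  have := dom (L + m + 2 * (x - m)).+1 ltac:(lia).
  by rewrite hx hy; lia.
have hx i : extremal_height x i = (L + x < i) + (clique_time x < i).
  by rewrite /extremal_height x_m.
split=> [[] dom|nbr].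
(* The prefix of length L contains y but no clique letter, so x cannot dominate. *)
- by have := dom L ltac:(lia); rewrite hx hy /clique_time; lia.
(* The second x must fall between the second and the third y, which is the condition y - m <= x < y
   - m + d. *)
- have := dom (clique_time x).+1.
  have := dom (2 * L + m + d + 2 * (y - m)).+1.
  by rewrite !hx !hy /clique_time; do ?case: ifP; lia.
by right=> i i_le; rewrite hx hy /clique_time; do ?case: ifP; lia.
Qed.

Lemma extremal_word_representable : word_representable extremal_adj.
Proof.
exists extremal_word; split=> [x|x y neq_xy].
  rewrite -has_pred1 has_count -[extremal_word]take_size.
  rewrite -[count _ _]/(height extremal_word x _) size_extremal_word.
  have := ltn_ord x.
  rewrite height_extremal_word // /extremal_height.
  by case: ifP; lia.
case: (ltngtP x y) => [lt_xy|lt_yx|/val_inj eq_xy].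
- exact: alternate_extremal.
- by rewrite alternate_sym // extremal_adj_sym; apply: alternate_extremal.
by rewrite eq_xy eqxx in neq_xy.
Qed.

Definition extremal_clique : {set 'I_(m + L)} :=
  [set x : 'I_(m + L) | x < m].

Lemma card_extremal_clique : #|extremal_clique| = m.
Proof.
rewrite (card_ord_count _ (fun i => 0 <= i < m)) count_iota_interval subn0.
exact/minn_idPl/leq_addr.
Qed.

Lemma extremal_split : split_graph_with extremal_adj extremal_clique m.
Proof.
split; last 1 first.
- by move=> x y; rewrite !inE /extremal_adj => /negPf-> /negPf->.
- split; first exact: extremal_adj_sym.
  by move=> x; rewrite /extremal_adj eqxx; case: ltnP.
- by move=> x y; rewrite !inE /extremal_adj => -> ->.
- exact: card_extremal_clique.
move=> v; rewrite inE -leqNgt => le_mv; have v_lt := ltn_ord v.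
have lt_last : m.-1 < m + L by lia.
have lt_first : 0 < m + L by lia.
(* A neighbourhood ending before the letter m - 1 misses it; any other starts at m - d > 0 or later
   and misses the letter 0. *)
case: (ltnP (v - m + d) m) => [lt_vm|le_vm].
  exists (Ordinal lt_last); rewrite ?inE /extremal_adj /= ?ltnNge ?le_mv /=; lia.
exists (Ordinal lt_first); rewrite ?inE /extremal_adj /= ?ltnNge ?le_mv /=; lia.
Qed.

Lemma extremal_nbhd (v : 'I_(m + L)) : m <= v ->
  nbhd extremal_adj v = [set x : 'I_(m + L) | v - m <= x < v - m + d].
Proof.
move=> le_mv; have v_lt := ltn_ord v; apply/setP=> x.
by rewrite !inE /extremal_adj ltnNge le_mv /=; lia.
Qed.

Lemma extremal_deg (v : 'I_(m + L)) : m <= v -> deg extremal_adj v = d.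
Proof.
move=> le_mv; have v_lt := ltn_ord v; rewrite /deg extremal_nbhd //.
rewrite (card_ord_count _ (fun i => v - m <= i < v - m + d)) count_iota_interval.
by lia.
Qed.

Lemma extremal_nbhd_inj :
  {in ~: extremal_clique &, injective (nbhd extremal_adj)}.
Proof.
move=> u v; rewrite !inE -!leqNgt => le_mu le_mv.
rewrite !extremal_nbhd // => /setP eq_uv; apply/val_inj => /=.
have u_lt := ltn_ord u; have v_lt := ltn_ord v.
have lt_u : u - m < m + L by lia.
have lt_v : v - m < m + L by lia.
(* Each interval contains the left end of the other, so the left ends agree. *)
have := eq_uv (Ordinal lt_u); have := eq_uv (Ordinal lt_v).
by rewrite !inE /=; lia.
Qed.

End Extremal.

Theorem theorem13 :
  (forall (T : finType) (e : rel T) (K : {set T}) (m d : nat),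
     split_graph_with e K m -> word_representable e ->
     4 <= m -> m + 1 < 2 * d -> d <= m - 1 ->
     forall S : {set T}, S \subset ~: K ->
       (forall v, v \in S -> deg e v = d) ->
       {in S &, injective (nbhd e)} ->
       #|S| <= m - d + 1)
  /\
  (forall m d : nat, 4 <= m -> m + 1 < 2 * d -> d <= m - 1 ->
     exists (n : nat) (e : rel 'I_n) (K S : {set 'I_n}),
       split_graph_with e K m /\ word_representable e /\
       S \subset ~: K /\
       (forall v, v \in S -> deg e v = d) /\
       {in S &, injective (nbhd e)} /\
       #|S| = m - d + 1).
Proof.
split=> [T e K m d split_e wr_e m4 md dm S|m d m4 md dm].
  by apply: word_representable_split_bound split_e wr_e md _ S; lia.
set L := m - d + 1.
have mE : m + 1 = d + L by rewrite /L; lia.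
have L_gt1 : 1 < L by rewrite /L; lia.
have L_ltd : L < d by rewrite /L; lia.
exists (m + L), (@extremal_adj m d L), (extremal_clique m L).
exists (~: extremal_clique m L).
split; first exact: extremal_split.
split; first exact: extremal_word_representable.
split; first exact: subxx.
split; first by move=> v; rewrite !inE -leqNgt; apply: extremal_deg.
split; first exact: extremal_nbhd_inj.
by rewrite cardsCs setCK card_extremal_clique card_ord addnC addnK.
Qed.
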